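(* For every prime $m\geq 3$ and every $G\in\{\Gamma(\mathbb{Z}_6),\Gamma(\mathbb{Z}_9),\overline{\Gamma(\mathbb{Z}_6)},\overline{\Gamma(\mathbb{Z}_9)}\}$, the join graph $\Gamma(\mathbb{Z}_{2m})+G$ does not admit a distance antimagic labeling.
   Context: For an integer $n \geq 2$, the zero-divisor graph $\Gamma(\mathbb{Z}_n)$ is the simple graph whose vertex set is the set of nonzero zero-divisors of the ring $\mathbb{Z}_n$, two distinct vertices $u,v$ being adjacent iff $uv \equiv 0 \pmod n$. $\overline{H}$ denotes the complement of a graph $H$. For graphs $G,H$, the join $G+H$ is the graph obtained from the disjoint union of $G$ and $H$ by adding every edge between a vertex of $G$ and a vertex of $H$. A distance antimagic labeling (DAML) of a graph $G$ with $N$ vertices is a bijection $f:V(G)\to\{1,\dots,N\}$ such that the weights $w(v)=\sum_{u\in N(v)} f(u)$, where $N(v)$ is the open neighbourhood of $v$, are pairwise distinct over all vertices $v$. A graph admits DAML if such a labeling exists. *)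

(* Defs.v *)
From HB Require Import structures.
From mathcomp Require Import all_boot all_order all_algebra.

Set Implicit Arguments.
Unset Strict Implicit.
Unset Printing Implicit Defensive.

Import GRing.Theory.

Record sgraph := SGraph {
  vertex :> finType;
  adj : rel vertex;
  adj_sym : symmetric adj;
  adj_irrefl : irreflexive adj
}.

Section Complement.
Variable G : sgraph.

Definition compl_adj (u v : G) : bool := (u != v) && ~~ adj u v.

Lemma compl_adj_sym : symmetric compl_adj.
Proof. by move=> u v; rewrite /compl_adj eq_sym adj_sym. Qed.

Lemma compl_adj_irrefl : irreflexive compl_adj.
Proof. by move=> u; rewrite /compl_adj eqxx. Qed.

Definition complement : sgraph := SGraph compl_adj_sym compl_adj_irrefl.
End Complement.

Section Join.
Variables G H : sgraph.

Definition join_adj (u v : G + H) : bool :=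
  match u, v with
  | inl x, inl y => adj x y
  | inr x, inr y => adj x y
  | _, _ => true
  end.

Lemma join_adj_sym : symmetric join_adj.
Proof. by move=> [u|u] [v|v] //=; exact: adj_sym. Qed.

Lemma join_adj_irrefl : irreflexive join_adj.
Proof. by move=> [u|u] /=; exact: adj_irrefl. Qed.

Definition join : sgraph := SGraph join_adj_sym join_adj_irrefl.
End Join.

Section ZeroDivisorGraph.
Local Open Scope ring_scope.

(* ['Z_n] is the ring of integers modulo n only for n >= 2 ('Z_0 and 'Z_1 both
   denote the integers modulo 2), so [zdgraph n] is meaningful for n >= 2. *)
Variable n : nat.

Definition nz_zero_divisor (x : 'Z_n) : bool :=
  (x != 0) && [exists y : 'Z_n, (y != 0) && (x * y == 0)].

Definition zd_vertex : finType := {x : 'Z_n | nz_zero_divisor x}.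

Definition zd_adj (u v : zd_vertex) : bool :=
  (u != v) && (val u * val v == 0).

Lemma zd_adj_sym : symmetric zd_adj.
Proof. by move=> u v; rewrite /zd_adj eq_sym mulrC. Qed.

Lemma zd_adj_irrefl : irreflexive zd_adj.
Proof. by move=> u; rewrite /zd_adj eqxx. Qed.

Definition zdgraph : sgraph := SGraph zd_adj_sym zd_adj_irrefl.
End ZeroDivisorGraph.

Definition weight (G : sgraph) (f : G -> nat) (v : G) : nat :=
  \sum_(u : G | adj v u) f u.

Definition is_DAML (G : sgraph) (f : G -> nat) : Prop :=
  [/\ injective f,
      forall k : nat, (exists v : G, f v = k) <-> 1 <= k <= #|G|
    & injective (weight f)].

Definition admits_DAML (G : sgraph) : Prop :=
  exists f : G -> nat, is_DAML f.

(* Main.v *)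
Require Import Defs.
From mathcomp Require Import all_boot all_order all_algebra.

Import GRing.Theory.

(* The ring elements 2 and 4 are non-adjacent vertices of the zero-divisor graph
   of Z_2m with the same annihilator, because 2 is invertible modulo the odd
   number m.  They therefore have equal open neighbourhoods, also after joining
   with any graph, so every labeling gives them equal weights. *)

Lemma twins_not_admits_DAML (G : sgraph) (u v : G) :
  u != v -> adj u =1 adj v -> ~ admits_DAML G.
Proof.
move=> /eqP neq_uv eq_uv [f [_ _ inj_w]]; apply/neq_uv/inj_w.
exact: eq_bigl.
Qed.

Lemma join_twins_not_admits_DAML (G H : sgraph) (u v : G) :
  u != v -> adj u =1 adj v -> ~ admits_DAML (join G H).
Proof.
move=> neq_uv eq_uv.
apply: (@twins_not_admits_DAML (join G H) (inl u) (inl v)) => //.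
by case=> w /=.
Qed.

(** If [u] is not its own annihilator, the clause [u != v] is automatic, so the neighbourhood of [u]
    is cut out by its annihilator alone. *)
Lemma zd_adj_sq_neq0 (n : nat) (u v : zd_vertex n) :
  (val u * val u != 0 -> zd_adj u v = (val u * val v == 0))%R.
Proof. by move=> uu; rewrite /zd_adj; case: eqVneq => // <-; rewrite (negbTE uu). Qed.

Section TwiceOdd.
Local Open Scope ring_scope.
Variable m : nat.
Hypotheses (odd_m : odd m) (m_ge3 : (3 <= m)%N).

Let m2_gt1 : (1 < 2 * m)%N.
Proof. by rewrite (leq_trans (ltnW m_ge3)) // leq_pmull. Qed.

Lemma natr_Zp_double_eq0 k : ((k%:R : 'Z_(2 * m)) == 0) = (2 * m %| k)%N.
Proof. by rewrite -(inj_eq val_inj) /= val_Zp_nat. Qed.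

Lemma annihilator_2_4 (x : 'Z_(2 * m)) : (2%:R * x == 0) = (4%:R * x == 0).
Proof.
apply/eqP/eqP => [x2|x4].
  by rewrite (natrM _ 2 2) -mulrA x2 mulr0.
have := mul0r x; rewrite -(pchar_Zp m2_gt1).
(* As [m] is odd, 2m leaves remainder 2 modulo 4; hence 0 = 2m x = (m/2)(4x) + 2x with m/2 rounded
   down, and 4x = 0 forces 2x = 0. *)
have /(congr1 (GRing.natmul 1)) -> : (2 * m = m./2 * 4 + 2)%N.
  by rewrite -{1}(odd_double_half m) odd_m mulnDr muln1 -mul2n mulnA mulnC addnC.
by rewrite natrD mulrDl natrM -mulrA x4 mulr0 add0r.
Qed.

Lemma four_neq0 : (4%:R : 'Z_(2 * m)) != 0.
Proof.
rewrite natr_Zp_double_eq0; apply/negP => /dvdn_leq => /(_ isT).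
by rewrite leqNgt (leq_trans _ (leq_mul (leqnn 2) m_ge3)).
Qed.

Lemma two_neq_four : (2%:R : 'Z_(2 * m)) != 4%:R.
Proof.
(* Taking x = 1 in [annihilator_2_4] turns 4 != 0 into 2 != 0, whereas 2 = 4 would give 2 = 4 - 2 =
   0. *)
have := four_neq0; rewrite -{1}[4%:R]mulr1 -annihilator_2_4 mulr1.
by apply: contra => /eqP e; rewrite -(addrK 2%:R 2%:R) -natrD -e subrr.
Qed.

Lemma two_neq0 : (2%:R : 'Z_(2 * m)) != 0.
Proof. by rewrite -[2%:R]mulr1 annihilator_2_4 mulr1 four_neq0. Qed.

Lemma m_neq0 : (m%:R : 'Z_(2 * m)) != 0.
Proof.
have m_gt0 : (0 < m)%N by apply: leq_trans m_ge3.
by rewrite natr_Zp_double_eq0 gtnNdvd // mul2n -addnn -[X in (X < _)%N]add0n ltn_add2r.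
Qed.

Lemma nz_zero_divisor_2 : nz_zero_divisor (2%:R : 'Z_(2 * m)).
Proof.
rewrite /nz_zero_divisor two_neq0; apply/existsP; exists m%:R.
by rewrite m_neq0 -natrM pchar_Zp // eqxx.
Qed.

Lemma nz_zero_divisor_4 : nz_zero_divisor (4%:R : 'Z_(2 * m)).
Proof.
(* The witness [m] that kills 2 also kills 4, the two annihilators being equal. *)
rewrite /nz_zero_divisor four_neq0; apply/existsP; exists m%:R.
by rewrite m_neq0 -annihilator_2_4 -natrM pchar_Zp // eqxx.
Qed.

Let v2 : zdgraph (2 * m) := Sub 2%:R nz_zero_divisor_2.
Let v4 : zdgraph (2 * m) := Sub 4%:R nz_zero_divisor_4.

Lemma zdgraph_double_odd_twins :
  exists u v : zdgraph (2 * m), u != v /\ adj u =1 adj v.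
Proof.
exists v2, v4; split; first by rewrite -(inj_eq val_inj) two_neq_four.
(* The side goals say that 2 and 4 have nonzero squares; trading factors 4 for 2 reduces both to 4
   != 0. *)
move=> w; rewrite /= !zd_adj_sq_neq0 /= ?annihilator_2_4 //.
  by rewrite -annihilator_2_4 mulrC -annihilator_2_4 -natrM four_neq0.
by rewrite -annihilator_2_4 -natrM four_neq0.
Qed.

End TwiceOdd.

Theorem theorem2p2 (m : nat) (G : sgraph) :
  prime m -> 3 <= m ->
  [\/ G = zdgraph 6, G = zdgraph 9,
      G = complement (zdgraph 6) | G = complement (zdgraph 9)] ->
  ~ admits_DAML (join (zdgraph (2 * m)) G).
Proof.
move=> m_prime m_ge3 _.
have odd_m : odd m by case: (even_prime m_prime) m_ge3 => // ->.
have [u [v [neq_uv eq_uv]]] := @zdgraph_double_odd_twins m odd_m m_ge3.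
exact: (join_twins_not_admits_DAML _ _ _ _ neq_uv eq_uv).
Qed.
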